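(* For a graph $G$, let $N(G)$ denote the number of Hamiltonian cycles of $G$ up to symmetry. For every $n\in\mathbb{N}$ there is a graph $G_n$ on $n$ vertices such that $N(G_n)=2^{\Theta(n\log n)}$; that is, there exist a sequence of graphs $(G_n)_{n}$ with $|V(G_n)|=n$, constants $c,C>0$ and $n_0\in\mathbb{N}$ such that $2^{c\,n\log n}\le N(G_n)\le 2^{C\,n\log n}$ for all $n\ge n_0$.
   Context: All graphs are finite, simple and undirected. A Hamiltonian cycle is a cycle (of length at least 3) through all vertices, identified with its edge set. The number of Hamiltonian cycles of $G$ up to symmetry is the number of orbits of the action of the automorphism group $\operatorname{Aut}(G)$ on the set of Hamiltonian cycles of $G$. *)

(* Defs.v *)
From mathcomp Require Import all_boot all_fingroup.

Set Implicit Arguments.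
Unset Strict Implicit.
Unset Printing Implicit Defensive.

Local Open Scope group_scope.

Record sgraph := SGraph {
  svertex :> finType;
  sedge : rel svertex;
  sedge_sym : symmetric sedge;
  sedge_irrefl : irreflexive sedge
}.

Definition graph_aut (G : sgraph) : {set {perm G}} :=
  [set s : {perm G} | [forall x, forall y, sedge (s x) (s y) == sedge x y]].

Lemma graph_autP (G : sgraph) (s : {perm G}) :
  reflect (forall x y, sedge (s x) (s y) = sedge x y) (s \in graph_aut G).
Proof.
rewrite inE; apply: (iffP forallP) => [H x y|H x].
  by have /forallP/(_ y)/eqP := H x.
by apply/forallP => y; rewrite H.
Qed.

Lemma graph_aut_group_set (G : sgraph) : group_set (graph_aut G).
Proof.
apply/group_setP; split; first by apply/graph_autP => x y; rewrite !perm1.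
by move=> s t /graph_autP Hs /graph_autP Ht; apply/graph_autP => x y;
   rewrite !permM Ht Hs.
Qed.

Canonical graph_aut_group (G : sgraph) := Group (graph_aut_group_set G).

(* The sequence c, read cyclically, lists the vertices of a Hamiltonian cycle. *)
Definition ham_seq (G : sgraph) (c : seq G) : bool :=
  [&& 2 < size c, ucycleb (@sedge G) c & [forall x, x \in c]].

Definition cycle_edges (T : finType) (c : seq T) : {set {set T}} :=
  [set [set x; next c x] | x in c].

(* Hamiltonian cycles as edge sets: sequences differing by a rotation or a
   reversal yield the same element.  Tuples only serve to make the indexing
   type finite, since a duplicate-free spanning sequence has size #|G|. *)
Definition ham_cycles (G : sgraph) : {set {set {set G}}} :=
  [set cycle_edges c | c : #|G|.-tuple G & ham_seq c].

(* The action of permutations of the vertices on sets of edges, an edge being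
   a set of vertices. *)
Notation edge_set_act G := ('P^*^* : {action {perm G} &-> {set {set G}}})%act.

Lemma cycle_edges_map (T : finType) (s : {perm T}) (c : seq T) : uniq c ->
  cycle_edges (map s c) = ('P^*^*)%act (cycle_edges c) s.
Proof.
move=> Uc; have E x : x \in c ->
    ('P^*)%act [set x; next c x] s = [set s x; next (map s c) (s x)].
  move=> xc; rewrite (next_map (@perm_inj _ s)) //.
  by rewrite /= /setact imsetU1 imset_set1 /= !apermE.
apply/setP => A; apply/imsetP/imsetP => [[y yc ->]|[B /imsetP[x xc ->] ->]].
  have /mapP[x xc ->] := yc.
  by exists [set x; next c x]; [apply: imset_f|rewrite E].
by exists (s x); rewrite ?map_f //; apply: E.
Qed.

Lemma graph_aut_acts (G : sgraph) :
  [acts graph_aut G, on ham_cycles G | edge_set_act G].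
Proof.
apply/subsetP => s sA; rewrite /astabs !inE /=; apply/subsetP => F.
case/imsetP => c; rewrite inE => /and3P[sz /andP[cy Uc] /forallP sp] ->.
rewrite inE /= -cycle_edges_map //; apply/imsetP.
exists [tuple of map s c] => //; rewrite inE /ham_seq /ucycleb /= size_map sz.
rewrite (map_inj_uniq (@perm_inj _ s)) Uc /= andbT; apply/andP; split.
  rewrite cycle_map (eq_cycle (e' := @sedge G)) // => x y.
  exact: (elimT (graph_autP s) sA x y).
by apply/forallP => x; rewrite -(permKV s x) map_f.
Qed.

Definition num_ham_cycles_upto_sym (G : sgraph) : nat :=
  #|orbit (edge_set_act G) (graph_aut G) @: ham_cycles G|.

(* Main.v *)
(* Put k = n/2 and join a path on 0, ..., k-1 to a clique on k, ..., n-1 by the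
   matching i ~ k + i and the extra edge k-1 ~ k.  Degrees separate the path
   from the clique and single out 0, the only vertex of degree 2; moving along
   the path and then across the matching, an automorphism fixes every vertex, so
   Hamiltonian cycles are counted without symmetry.  Each ordering t of the clique
   minus {k, 2k-1} yields the Hamiltonian cycle 0, ..., k-1, 2k-1, t, k, whence
   at least (n-k-2)! of them, and there are at most n^n. *)
Require Import Defs.
From mathcomp Require Import all_boot all_order all_algebra all_fingroup.
From mathcomp Require Import zify.
From mathcomp Require Import reals sequences exp.

Set Implicit Arguments.
Unset Strict Implicit.
Unset Printing Implicit Defensive.

(** * Recovering a cycle from its edge set *)

Lemma next_next_neq (T : eqType) (c : seq T) (z : T) :
  uniq c -> 2 < size c -> z \in c -> next c (next c z) != z.
Proof.
move=> Uc sz zc; have [i s def_c] := rot_to zc.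
rewrite -!(next_rot i Uc) def_c.
move: Uc sz; rewrite -(rot_uniq i) -(size_rot i) def_c.
case: s {def_c} => [|a [|b r]] //= /andP[+ _] _.
rewrite !inE !negb_or => /and3P[za zb _].
by rewrite eqxx [a == z]eq_sym (negPf za) eqxx eq_sym.
Qed.

(* Along a cycle, the current vertex and its predecessor determine the
   successor from the edge set, so two starting vertices determine the rest. *)
Lemma cycle_edges_inj (T : finType) (x : T) (p q : seq T) :
  uniq (x :: p) -> uniq (x :: q) -> 2 < size (x :: p) ->
  size p = size q -> head x p = head x q ->
  cycle_edges (x :: p) = cycle_edges (x :: q) -> p = q.
Proof.
move=> Up Uq sz szpq hpq Epq.
have szq : 2 < size (x :: q) by rewrite /= -szpq.
set c := x :: p in Up sz Epq; set d := x :: q in Uq szq Epq.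
have xd : x \in d by rewrite mem_head.
have nx0 : next c x = next d x.
  rewrite /c /d /=; case: (p) (q) szpq hpq => [|a p'] [|b q'] //= _ ->.
  by rewrite eqxx.
have memd m : iter m (next d) x \in d.
  by elim: m => // m IH; rewrite iterS mem_next.
have memc m : iter m (next c) x \in c.
  by elim: m => [|m IH]; rewrite ?mem_head // iterS mem_next.
(* Two consecutive vertices are carried through the induction, since the predecessor is what rules
   out the wrong neighbour. *)
have it m : iter m (next c) x = iter m (next d) x
         /\ iter m.+1 (next c) x = iter m.+1 (next d) x.
  elim: m => [//|m [IH1 IH2]]; split=> //.
  set y := iter m.+1 (next c) x in IH2 *.
  have : [set y; next c y] \in cycle_edges d.
    by rewrite -Epq; apply/imsetP; exists y => //; apply: (memc m.+1).
  case/imsetP => z zd Ez.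
  change (next c y = next d (iter m.+1 (next d) x)); rewrite -IH2.
  have yz : y \in [set z; next d z] by rewrite -Ez !inE eqxx.
  have nz : next c y \in [set z; next d z] by rewrite -Ez !inE eqxx orbT.
  have zy : z \in [set y; next c y] by rewrite Ez !inE eqxx.
  have zy' : next d z \in [set y; next c y] by rewrite Ez !inE eqxx orbT.
  have yn : y != next c y.
    apply/eqP=> yn; have := next_next_neq Up sz (memc m.+1).
    by rewrite -/y -!yn eqxx.
  (* If [y] is [z], the successors agree. Otherwise [next c y] would be the predecessor of [y], a
     step back that [next_next_neq] forbids. *)
  case/set2P: yz => yz.
    rewrite -yz in nz; case/set2P: nz => // nz.
    by rewrite nz eqxx in yn.
  case/set2P: nz => nz; last by rewrite nz yz eqxx in yn.
  have zE : z = iter m (next d) x.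
    by rewrite -(prev_next Uq z) -yz IH2 iterS prev_next.
  have := next_next_neq Up sz (memc m).
  by rewrite -[next c (iter m _ _)]/y nz zE IH1 eqxx.
have Ec : fpath (next c) x p.
  by move: (cycle_next Up); rewrite /= rcons_path => /andP[].
have Ed : fpath (next d) x q.
  by move: (cycle_next Uq); rewrite /= rcons_path => /andP[].
suff [] : x :: p = x :: q by [].
rewrite (fpathE Ec) (fpathE Ed) -szpq -!trajectS.
apply: (@eq_from_nth _ x); rewrite ?size_traject // => i isz.
by rewrite !nth_traject //; case: (it i).
Qed.

(** * The path-clique graph *)

Definition pc_arc (k i j : nat) : bool :=
  (i < j) && [|| j == i.+1, j == i + k | k <= i].

(** [pc_arc] describes each edge from its smaller end: [j == i.+1] gives the path and the extra edge
    from [k - 1] to [k], [j == i + k] the matching, [k <= i] the clique. *)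
Definition pc_edge (k i j : nat) : bool := pc_arc k i j || pc_arc k j i.

Definition pc_adj (k n : nat) : rel 'I_n := fun i j => pc_edge k i j.

Lemma pc_adj_sym k n : symmetric (@pc_adj k n).
Proof. by move=> i j; rewrite /pc_adj /pc_edge orbC. Qed.

Lemma pc_adj_irrefl k n : irreflexive (@pc_adj k n).
Proof. by move=> i; rewrite /pc_adj /pc_edge /pc_arc ltnn. Qed.

Lemma path_iota_pc k i m : path (pc_edge k) i (iota i.+1 m).
Proof.
by elim: m i => //= m IH i; rewrite IH /pc_edge /pc_arc ltnSn eqxx.
Qed.

Lemma path_ge_pc k i s :
  uniq (i :: s) -> all (leq k) (i :: s) -> path (pc_edge k) i s.
Proof.
elim: s i => //= j s IH i /and3P[]; rewrite inE negb_or => /andP[ij _] js us.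
case/and3P => ki kj ks; rewrite IH /= ?js ?kj // andbT.
by rewrite /pc_edge /pc_arc; lia.
Qed.

Lemma last_iota i m : last i (iota i.+1 m) = i + m.
Proof. by elim: m i => [|m IH] i /=; rewrite ?addn0 // IH addnS. Qed.

Definition path_clique (k n : nat) : sgraph :=
  SGraph (@pc_adj_sym k n) (@pc_adj_irrefl k n).

(** * Automorphisms, degrees and general bounds on the count *)

Definition nbhd (G : sgraph) (x : G) : {set G} := [set y | sedge x y].

Lemma card_nbhd_aut (G : sgraph) (s : {perm G}) (x : G) :
  s \in graph_aut G -> #|nbhd (s x)| = #|nbhd x|.
Proof.
move=> /graph_autP sA; rewrite -(card_imset (nbhd x) (@perm_inj _ s)).
apply: eq_card => y; rewrite inE -{1}(permKV s y) sA.
by rewrite -{2}(permKV s y) mem_imset ?inE //; apply: perm_inj.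
Qed.

Lemma num_ham_cycles_rigid (G : sgraph) :
  graph_aut G \subset [1 {perm G}]%g -> num_ham_cycles_upto_sym G = #|ham_cycles G|.
Proof.
move=> /subsetP A1; apply: card_in_imset => E F _ _ EF.
have /imsetP[s /A1 /set1P -> ->] : E \in orbit (edge_set_act G) (graph_aut G) F.
  by rewrite -EF orbit_refl.
by rewrite act1.
Qed.

(** Orbits are images of Hamiltonian cycles, which are images of [#|G|]-tuples of vertices. *)
Lemma num_ham_cycles_leq (G : sgraph) : num_ham_cycles_upto_sym G <= #|G| ^ #|G|.
Proof.
apply: leq_trans (leq_imset_card _ _) _; apply: leq_trans (leq_imset_card _ _) _.
by rewrite -card_tuple; apply: max_card.
Qed.

(** * Rigidity of the path-clique graph *)

Section PathClique.
Variables k n : nat.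
Hypotheses (k5 : 5 <= k) (nlo : k.*2 <= n) (nhi : n <= k.*2.+1).
Let G := path_clique k n.
Implicit Types x y : 'I_n.

Lemma card_nbhd_path x : x < k -> #|nbhd (x : G)| <= 3.
Proof.
move=> xk; have xn := ltn_ord x.
have [l1 l2 l3] : [/\ x.-1 < n, x.+1 < n & x + k < n] by split; lia.
apply: (@leq_trans #|[set Ordinal l1; Ordinal l2; Ordinal l3]|).
  apply: subset_leq_card; apply/subsetP => y; rewrite !inE -!val_eqE /=.
  by rewrite /pc_adj /pc_edge /pc_arc; lia.
by rewrite -setUA cardsU1 cards2; lia.
Qed.

Lemma card_nbhd_path_start x : x = 0 :> nat -> #|nbhd (x : G)| <= 2.
Proof.
move=> x0; have [l1 l2] : 1 < n /\ k < n by lia.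
apply: (@leq_trans #|[set Ordinal l1; Ordinal l2]|); last by rewrite cards2; lia.
apply: subset_leq_card; apply/subsetP => y; rewrite !inE -!val_eqE /=.
by rewrite /pc_adj /pc_edge /pc_arc; lia.
Qed.

Lemma card_nbhd_path_inner x : 0 < x -> x < k -> 2 < #|nbhd (x : G)|.
Proof.
move=> x0 xk; have xn := ltn_ord x.
have [l1 l2 l3] : [/\ x.-1 < n, x.+1 < n & x + k < n] by split; lia.
apply: (@leq_trans #|[set Ordinal l1; Ordinal l2; Ordinal l3]|).
  by rewrite -setUA cardsU1 cards2 !inE -!val_eqE /=; lia.
apply: subset_leq_card; apply/subsetP => y; rewrite !inE -!val_eqE /=.
by rewrite /pc_adj /pc_edge /pc_arc; lia.
Qed.

Lemma card_nbhd_clique x : k <= x -> 3 < #|nbhd (x : G)|.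
Proof.
(* Among the five clique vertices [k], ..., [k + 4], at least four differ from [x], one more than
   the degree of a path vertex can be. *)
move=> kx; have lt5 (i : 'I_5) : k + i < n by have := ltn_ord i; lia.
pose f i : 'I_n := Ordinal (lt5 i).
have injf : injective f.
  by move=> i j /(congr1 val) /= /addnI; apply: val_inj.
pose S := [set f i | i : 'I_5].
have cS : #|S| = 5 by rewrite card_imset // card_ord.
apply: (@leq_trans #|S :\ x|); first by move: cS; rewrite (cardsD1 x); lia.
apply: subset_leq_card; apply/subsetP => y; rewrite !inE => /andP[yx].
case/imsetP => i _ yE; move: yx; rewrite -val_eqE yE /=.
by rewrite /pc_adj /pc_edge /pc_arc /=; lia.
Qed.

Lemma pc_edge_rigid (f : 'I_n -> 'I_n) :
  injective f -> (forall x y, pc_edge k (f x) (f y) = pc_edge k x y) ->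
  (forall x, (f x < k) = (x < k)) ->
  (forall x, x = 0 :> nat -> f x = 0 :> nat) -> f =1 id.
Proof.
move=> injf adj fP f0 x0.
have f_neq x y : f x = f y :> nat -> x = y :> nat by move=> /val_inj /injf ->.
have path_fixed m : forall x : 'I_n, x < m -> x < k -> f x = x :> nat.
  elim: m => // m IH x; rewrite ltnS leq_eqVlt => /orP[/eqP xm xk|]; last first.
    exact: IH.
  have fxk : f x < k by rewrite fP.
  case: (posnP x) => x0'; first by rewrite x0' f0.
  (* [f x] is a path neighbour of the fixed vertex [x - 1], hence [x] or [x - 2]; by injectivity the
     latter is taken by [x - 2]. *)
  have l1 : x.-1 < n by have := ltn_ord x; lia.
  have e1 := IH (Ordinal l1); have := adj (Ordinal l1) x.
  rewrite /= in e1; rewrite e1 /pc_edge /pc_arc /=; [|lia|lia].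
  have [x1|x1] := leqP x 1; first lia.
  have l2 : x.-2 < n by have := ltn_ord x; lia.
  have e2 := IH (Ordinal l2); have := f_neq (Ordinal l2) x.
  by rewrite /= in e2 *; rewrite e2; lia.
(* The clique neighbours of the fixed vertex [x - k] are [x] and, through the extra edge when
   [x = 2k - 1], also [k]. *)
have clique_adj (x : 'I_n) : k <= x -> x < k.*2 ->
    f x = x :> nat \/ x = k.*2.-1 :> nat /\ f x = k :> nat.
  move=> kx x2k; have fxk := fP x.
  have l1 : x - k < n by have := ltn_ord x; lia.
  have e1 := path_fixed k (Ordinal l1); have := adj (Ordinal l1) x.
  by rewrite /= in e1; rewrite e1 /pc_edge /pc_arc /=; lia.
(* As [k] itself is fixed, injectivity excludes the second alternative. *)
have fixed_lt_2k (x : 'I_n) : x < k.*2 -> f x = x :> nat.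
  case: (ltnP x k) => [xk _|kx x2k]; first exact: path_fixed xk.
  have l1 : k < n by lia.
  have := clique_adj (Ordinal l1); have := clique_adj x kx x2k.
  by have := f_neq x (Ordinal l1); rewrite /=; lia.
(* Only the unmatched vertex [2k], present for odd [n], remains; all other values are taken. *)
apply: val_inj => /=; case: (ltnP x0 k.*2) => [|x0k]; first exact: fixed_lt_2k.
have [fx0|] := ltnP (f x0) k.*2; last first.
  by have := ltn_ord (f x0); have := ltn_ord x0; lia.
by have := f_neq _ _ (fixed_lt_2k _ fx0); lia.
Qed.

Lemma path_clique_rigid : graph_aut G \subset [1 {perm G}]%g.
Proof.
apply/subsetP => s sA; rewrite inE; apply/eqP/permP => x0; rewrite perm1.
have sP (x : 'I_n) : ((s x : 'I_n) < k) = (x < k).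
  have := card_nbhd_aut (x : G) sA.
  case: (ltnP x k) => xk; case: (ltnP (s x : 'I_n) k) => sxk //.
    by have := card_nbhd_path xk; have := card_nbhd_clique sxk; lia.
  by have := card_nbhd_path sxk; have := card_nbhd_clique xk; lia.
apply: (@pc_edge_rigid s) => //; first exact: perm_inj.
  exact: (elimT (graph_autP s) sA).
move=> x x0'; apply/eqP; rewrite -leqn0 leqNgt; apply/negP => sx0.
have sxk : (s x : 'I_n) < k by rewrite sP; lia.
have := card_nbhd_path_inner sx0 sxk.
by rewrite (card_nbhd_aut (x : G) sA) ltnNge card_nbhd_path_start.
Qed.

(** * A factorial family of Hamiltonian cycles *)

Lemma fact_leq_ham_cycles : (n - k - 2)`! <= #|ham_cycles G|.
Proof.
have [ltz lte ltw] : [/\ 0 < n, k.*2.-1 < n & k < n] by split; lia.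
pose z : 'I_n := Ordinal ltz; pose e : 'I_n := Ordinal lte.
pose w : 'I_n := Ordinal ltw.
pose P : seq 'I_n := pmap insub (iota 1 k.-1).
(* [M] lists the clique without [k] and [2k - 1]; the second range is empty or just [2k]. All
   numbers are below [n], so [insub] drops none. *)
pose M : seq 'I_n := pmap insub (iota k.+1 (k - 2) ++ iota k.*2 (n - k.*2)).
have val_insub (r : seq nat) :
    all (gtn n) r -> map val (pmap insub r : seq 'I_n) = r.
  move=> /allP rn; rewrite (pmap_filter (insubK _)); apply/all_filterP/allP => i.
  by move=> /rn; rewrite isSome_insub.
have valP : map val P = iota 1 k.-1.
  by apply: val_insub; apply/allP => i; rewrite mem_iota /=; lia.
have sizeP : size P = k.-1 by rewrite -(size_map val) valP size_iota.
have sizeM : size M = n - k - 2.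
  rewrite -(size_map val) val_insub ?size_cat ?size_iota; first lia.
  by apply/allP => i; rewrite mem_cat !mem_iota /=; lia.
have uniqM : uniq M.
  apply: pmap_sub_uniq; rewrite cat_uniq !iota_uniq andbT /=.
  by apply/hasPn => i; rewrite !mem_iota; lia.
(* After [0] and the path, the matching leads from [k - 1] to [e = 2k - 1], the clique is run
   through in the order [t], and [w = k] is matched back to [0]. *)
pose p t := P ++ e :: rcons t w.
have size_p t : perm_eq t M -> size (p t) = n.-1.
  by move/perm_size => st; rewrite size_cat /= size_rcons st sizeP sizeM; lia.
have mem_p t (x : 'I_n) : perm_eq t M -> x \in z :: p t.
  move/perm_mem => tM; rewrite inE mem_cat inE mem_rcons inE tM.
  rewrite !mem_pmap_sub mem_cat !mem_iota -!val_eqE /=.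
  by have := ltn_ord x; lia.
(* A list of [n] entries that contains all [n] vertices has no repetition. *)
have uniq_p t : perm_eq t M -> uniq (z :: p t).
  move=> tM; apply: (leq_size_uniq (enum_uniq 'I_n)) => [x _|].
    exact: mem_p.
  by rewrite size_enum_ord /= size_p //; lia.
have size3 t : perm_eq t M -> 2 < size (z :: p t).
  by move=> tM /=; rewrite size_p //; lia.
have ham_p t : perm_eq t M -> @ham_seq G (z :: p t).
  move=> tM; apply/and3P; split; [exact: size3| |]; last first.
    by apply/forallP => x; apply: mem_p.
  apply/andP; split; last exact: uniq_p.
  have -> : path.cycle (@sedge G) (z :: p t)
      = path (relpre val (pc_edge k)) z (rcons (p t) z) by [].
  rewrite -path_map /p rcons_cat map_cat valP cat_path path_iota_pc last_iota /=.
  rewrite map_rcons rcons_path map_rcons path_ge_pc ?last_rcons /=.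
  - by rewrite /pc_edge /pc_arc; lia.
  - have := uniq_p t tM; rewrite -cat_cons cat_uniq => /and3P[_ _].
    by rewrite -(map_inj_uniq val_inj) /= map_rcons.
  rewrite all_rcons leqnn /= all_map; apply/andP; split; first lia.
  apply/allP => x; rewrite (perm_mem tM) mem_pmap_sub mem_cat !mem_iota /=; lia.
pose F t := cycle_edges (z :: p t).
rewrite -sizeM -size_permutations // -(size_map F).
rewrite cardE; apply: uniq_leq_size => [|E].
  (* All these cycles leave [0] towards the same vertex, so [cycle_edges_inj] applies; cancelling
     the common prefix and the final [w] recovers [t]. *)
  rewrite map_inj_in_uniq ?permutations_uniq // => t u.
  rewrite !mem_permutations => tM uM.
  move/(cycle_edges_inj (uniq_p _ tM) (uniq_p _ uM) (size3 _ tM)).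
  rewrite !size_p // => /(_ erefl); rewrite /p; case: (P) => [|y P'] /(_ erefl).
    by move=> [] /rcons_inj [].
  move/(congr1 (drop (size (y :: P')))); rewrite !drop_size_cat //.
  by move=> [] /rcons_inj [].
case/mapP => t; rewrite mem_permutations => tM ->; rewrite mem_enum.
have st : size (z :: p t) == #|G| by rewrite card_ord /= size_p //; lia.
by apply/imsetP; exists (Tuple st) => //; rewrite inE; apply: ham_p.
Qed.

End PathClique.

(** * Factorial estimates and the final bounds *)

Lemma expn_leq_fact q d : q ^ d <= (q + d)`!.
Proof.
elim: d => [|d IH]; first by rewrite fact_gt0.
by rewrite addnS factS expnS leq_mul //; lia.
Qed.

(** With [q] about [n / 8], the factorial has [m - q] factors above [q]. Since [n <= q ^ 2] and
    [2n <= 8 (m - q)] for large [n], the eighth power suffices. *)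
Lemma expnn_leq_fact8 n : 100 <= n -> n ^ n <= ((n - n./2 - 2)`!) ^ 8.
Proof.
move=> n100; set m := n - n./2 - 2; pose q := n %/ 8.
have nq : n <= q ^ 2 by rewrite /q; nia.
apply: leq_trans (_ : (q ^ 2) ^ n <= _); first by rewrite leq_exp2r //; lia.
apply: leq_trans (_ : (q ^ (m - q)) ^ 8 <= _).
  by rewrite -!expnM leq_pexp2l // /m /q; lia.
rewrite leq_exp2r // {2}(_ : m = q + (m - q)) ?expn_leq_fact //.
by rewrite /m /q; lia.
Qed.

Import Order.TTheory GRing.Theory Num.Theory.
Local Open Scope ring_scope.

Lemma powR2_div_ln2 (R : realType) (x : R) : 2 `^ (x / ln 2) = expR x.
Proof. by rewrite /powR pnatr_eq0 /= divfK // gt_eqF // ln_gt0 // ltr1n. Qed.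

Lemma expR_mul_ln_nat (R : realType) (n : nat) : (0 < n)%N ->
  expR (n%:R * ln n%:R) = (n ^ n)%:R :> R.
Proof.
by move=> n0; rewrite mulrC expRM_natr lnK ?posrE ?ltr0n // natrX.
Qed.

Theorem proposition38 (R : realType) :
  exists (G : nat -> sgraph) (c C : R) (n0 : nat),
    [/\ forall n : nat, #|G n| = n,
        0 < c,
        0 < C &
        forall n : nat, (n0 <= n)%N ->
          2 `^ (c * (n%:R * ln n%:R))
            <= (num_ham_cycles_upto_sym (G n))%:R
            <= 2 `^ (C * (n%:R * ln n%:R))].
Proof.
have ln2 : 0 < ln (2 : R) by rewrite ln_gt0 ?ltr1n.
(* Dividing by [ln 2] turns powers of 2 into exponentials, so [n ln n] yields [n ^ n]; the factor
   [8^-1] matches the exponent in [expnn_leq_fact8]. *)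
exists (fun n => path_clique n./2 n), (8^-1 / ln 2), (ln 2)^-1, 100%N.
split=> [n|||n n100]; first exact: card_ord.
- by rewrite divr_gt0 ?invr_gt0 ?ltr0n.
- by rewrite invr_gt0.
have n0 : (0 < n)%N by lia.
have [k5 nlo nhi] : [/\ 5 <= n./2, n./2.*2 <= n & n <= n./2.*2.+1]%N.
  by split; lia.
apply/andP; split; last first.
  rewrite mulrC powR2_div_ln2 expR_mul_ln_nat // ler_nat.
  by have := num_ham_cycles_leq (path_clique n./2 n); rewrite card_ord.
rewrite mulrAC powR2_div_ln2 mulrC num_ham_cycles_rigid ?path_clique_rigid //.
(* Eighth powers of both sides are compared, which makes the left one [n ^ n]. *)
rewrite -(@ler_pXn2r _ 8) ?nnegrE ?expR_ge0 ?ler0n //.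
rewrite -expRM_natr divfK ?pnatr_eq0 // expR_mul_ln_nat // -natrX ler_nat.
apply: leq_trans (expnn_leq_fact8 n100) _.
by rewrite leq_exp2r // fact_leq_ham_cycles.
Qed.
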